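(* Let $X=(X,d)$ be an ultrametric Polish space such that $R(d)$ contains an honest increasing sequence. Then there is a map $\psi$ from $\mathscr P(\omega)$ into the clopen subsets of $X$ such that for all $a,b\subseteq\omega$: $a\subseteq^*b\iff\psi(a)\le_{\mathsf L(d)}\psi(b)$.
   Context: An ultrametric Polish space is a separable metric space $(X,d)$ with $d$ a complete ultrametric. $R(d)=\{d(x,y):x,y\in X,\ x\ne y\}$. $R(d)$ contains an honest increasing sequence if there are a strictly increasing sequence $(r_n)_{n\in\omega}$ of elements of $R(d)$ and sequences $(x_n)_{n\in\omega},(y_n)_{n\in\omega}$ of points of $X$ with (i) $d(x_n,x_m)=r_{\max\{n,m\}}$ for all distinct $n,m$, and (ii) $d(x_0,y_0)<r_0$ and $d(x_{n+1},y_{n+1})<d(x_n,y_n)$ for all $n$. $a\subseteq^*b$ means $a\setminus b$ finite. $A\le_{\mathsf L(d)}B$ iff $A=f^{-1}(B)$ for some $f\colon X\to X$ with $d(f(x),f(y))\le d(x,y)$ for all $x,y$. *)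

(* Defs.v *)
From HB Require Import structures.
From mathcomp Require Import all_boot all_order all_algebra.
From mathcomp Require Import all_classical all_reals all_analysis.

Set Implicit Arguments.
Unset Strict Implicit.
Unset Printing Implicit Defensive.

Import Order.TTheory GRing.Theory Num.Theory.
Import numFieldNormedType.Exports.

Local Open Scope classical_set_scope.
Local Open Scope ring_scope.

Definition ultrametric (R : realType) (X : metricType R) : Prop :=
  forall x y z : X, mdist x z <= Num.max (mdist x y) (mdist y z).

Definition separable (T : topologicalType) : Prop :=
  exists2 D : set T, countable D & dense D.

(* Sequential completeness; [cvg] and [completeType] are not used because they
   require a distinguished point. *)
Definition complete_metric (R : realType) (X : metricType R) : Prop :=
  forall u : nat -> X, cauchy (u @ \oo) -> exists l : X, u @ \oo --> l.

Definition ultrametric_polish (R : realType) (X : metricType R) : Prop :=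
  [/\ separable X, ultrametric X & complete_metric X].

(* R(d) *)
Definition distance_set (R : realType) (X : metricType R) : set R :=
  [set r | exists x y : X, x <> y /\ mdist x y = r].

Definition has_honest_increasing_seq (R : realType) (X : metricType R) : Prop :=
  exists (r : nat -> R) (x y : nat -> X),
    [/\ forall n, distance_set X (r n),
        {homo r : n m / (n < m)%N >-> n < m},
        forall n m, n <> m -> mdist (x n) (x m) = r (maxn n m),
        mdist (x 0%N) (y 0%N) < r 0%N
      & forall n, mdist (x n.+1) (y n.+1) < mdist (x n) (y n)].

Definition almost_subset (a b : set nat) : Prop := finite_set (a `\` b).

Definition nonexpansive (R : realType) (X : metricType R) (f : X -> X) : Prop :=
  forall x y : X, mdist (f x) (f y) <= mdist x y.

(* A <=_{L(d)} B *)
Definition lipschitz_reducible (R : realType) (X : metricType R)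
    (A B : set X) : Prop :=
  exists f : X -> X, nonexpansive f /\ A = f @^-1` B.

(* Main.v *)
(** Put [s n := d (x n, y n)]. The open balls [U n] of centre [x n] and radius
    [s n] are pairwise far apart, and [psi a] is the union of the [U n] with
    [n] even, or [n = 2 k + 1] and [k \in a].  A nonexpansive reduction sends
    the pair [x n], [y n] to a pair of points at distance at most [s n], one
    inside some [U m] and the other outside it, so [s m <= s n] and [n <= m].
    Conversely, once [n] exceeds the index of the ball receiving [x 0], the
    bound [d (x 0, x n) = r n] forces [m <= n]; hence the reduction fixes the
    index of all but finitely many balls.  In the other direction, a finite
    part of [psi a] can be collapsed onto a single pair [x K], [y K], and the
    balls [U n] of [psi b] with large index that are missing from [psi a] can
    be collapsed to [y n]. *)
Require Import Defs.
From HB Require Import structures.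
From mathcomp Require Import all_boot all_order all_algebra.
From mathcomp Require Import all_classical all_reals all_analysis.
From mathcomp Require Import zify.

Set Implicit Arguments.
Unset Strict Implicit.
Unset Printing Implicit Defensive.

Import Order.TTheory GRing.Theory Num.Theory.

Local Open Scope classical_set_scope.
Local Open Scope ring_scope.

Section UltrametricSpace.
Context (R : realType) (X : metricType R).
Hypothesis ultraX : ultrametric X.
Implicit Types (u v w : X) (c : R).

Lemma mdist_lt_trans v u w c : mdist u v < c -> mdist v w < c -> mdist u w < c.
Proof.
by move=> uv vw; apply: le_lt_trans (ultraX u v w) _; rewrite gt_max uv.
Qed.

Lemma mdist_le_trans v u w c :
  mdist u v <= c -> mdist v w <= c -> mdist u w <= c.
Proof.
by move=> uv vw; apply: le_trans (ultraX u v w) _; rewrite ge_max uv.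
Qed.

Lemma mdist_ge_ball u v w c : mdist u v < c -> ~ mdist u w < c -> c <= mdist v w.
Proof.
by move=> uv uw; rewrite leNgt; apply/negP => vw; apply/uw/(mdist_lt_trans uv).
Qed.

Lemma open_mdist (A : set X) :
  (forall u, A u -> exists2 c, 0 < c & forall v, mdist u v < c -> A v) -> open A.
Proof.
move=> opA; rewrite openE => u /opA[c c0 uA]; apply/nbhs_ballP.
by exists c => // v; rewrite ballEmdist => /uA.
Qed.

Section HonestSequence.
Variables (r : nat -> R) (x y : nat -> X).
Hypothesis r_incr : {homo r : n m / (n < m)%N >-> n < m}.
Hypothesis dist_x : forall n m, n <> m -> mdist (x n) (x m) = r (maxn n m).
Hypothesis dist_xy0 : mdist (x 0%N) (y 0%N) < r 0%N.
Hypothesis dist_xyS : forall n, mdist (x n.+1) (y n.+1) < mdist (x n) (y n).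

(** * Separation of the balls [U n] *)

Let s n := mdist (x n) (y n).
Let U n : set X := [set z | mdist (x n) z < s n].

Let le_r : {mono r : n m / (n <= m)%N >-> n <= m}.
Proof. exact: le_mono. Qed.

Let le_s : {mono s : n m / (m <= n)%N >-> n <= m}.
Proof.
apply: le_nmono => n m; rewrite ltEnat /s /= => nm.
elim: n nm => // n IHn; rewrite ltnS leq_eqVlt => /orP[/eqP->//|/IHn].
exact: lt_trans.
Qed.

Let s_gt0 n : 0 < s n.
Proof. exact: le_lt_trans (mdist_ge0 _ _) (dist_xyS n). Qed.

Let s_lt_r n m : s n < r m.
Proof.
apply: le_lt_trans (_ : s 0%N < _); first by rewrite le_s.
by apply: lt_le_trans dist_xy0 _; rewrite le_r.
Qed.

Let r_gt0 n : 0 < r n.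
Proof. exact: lt_trans (s_gt0 0) (s_lt_r 0 n). Qed.

Let near_center n m : mdist (x n) (x m) < r 0%N -> n = m.
Proof.
by case: (n =P m) => // nm; rewrite dist_x// ltNge le_r.
Qed.

Let U_center n : U n (x n).
Proof. by rewrite /U/= mdistxx. Qed.

Let U_inj z n m : U n z -> U m z -> n = m.
Proof.
move=> nz mz; apply: near_center; apply: (@mdist_lt_trans z).
  exact: lt_trans nz _.
by rewrite metric_sym; apply: lt_trans mz _.
Qed.

(** The open ball [U n] has radius exactly [s n], so it misses [y n]; the other centres are too far,
    as [y n] is within [r 0] of [x n]. *)
Let U_y n m : ~ U m (y n).
Proof.
move=> mn; suff nm : n = m by move: mn; rewrite /U/= nm ltxx.
apply: near_center; apply: (@mdist_lt_trans (y n)); first exact: s_lt_r.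
by rewrite metric_sym; apply: lt_trans mn _.
Qed.

(* The even indices make [tag a] infinite, so that finite sets [a] are not
   distinguished from the empty one. *)
Definition tag (a : set nat) : set nat := [set k | odd k -> a k./2].

Definition balls (S : set nat) : set X := \bigcup_(n in S) U n.

Lemma balls_clopen S : clopen (balls S).
Proof.
split.
  apply: open_mdist => u [n Sn nu]; exists (s n) => // v uv.
  by exists n => //; apply: mdist_lt_trans nu uv.
rewrite -openC; apply: open_mdist => v nv.
(* Near a point within [r 0] of [x n], only [U n] can occur; a point with no such centre is at least
   [r 0] away from every ball. *)
have [[n vn]|far] := pselect (exists n, mdist (x n) v < r 0%N).
  exists (s n) => // w vw [m Sm mw].
  have nm : n = m.
    apply: near_center; apply: mdist_lt_trans vn _.
    apply: (@mdist_lt_trans w); first exact: lt_trans vw _.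
    by rewrite metric_sym; apply: lt_trans mw _.
  subst m; apply: nv; exists n => //; apply: mdist_lt_trans mw _.
  by rewrite metric_sym.
exists (r 0%N) => // w vw [m Sm mw]; apply: far; exists m.
by apply: (@mdist_lt_trans w); [exact: lt_trans mw _|rewrite metric_sym].
Qed.

(** * A reduction forces almost inclusion *)

Lemma almost_subset_of_reducible a b :
  lipschitz_reducible (balls (tag a)) (balls (tag b)) -> almost_subset a b.
Proof.
move=> [f [f1 fab]].
have image_ball n : tag a n ->
    exists m, [/\ tag b m, U m (f (x n)) & (n <= m)%N].
  move=> an.
  have : balls (tag a) (x n) by exists n.
  rewrite fab => -[m bm mx]; exists m; split=> //.
  rewrite -le_s; apply: le_trans (f1 (x n) (y n)).
  apply: mdist_ge_ball mx _ => my.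
  have : balls (tag a) (y n) by rewrite fab; exists m.
  by case=> k _ /U_y.
(* Index [0] is even, hence in [tag a] whatever [a] is. *)
have [|M [_ Mx _]] := image_ball 0%N; first by [].
apply: (@sub_finite_set _ _ `I_M) => [k [ak nbk]|]; last exact: finite_II.
rewrite /=ltnNge; apply/negP => Mk; apply: nbk.
pose n := k.*2.+1.
have [|m [bm mx nm]] := image_ball n.
  by rewrite /tag/= uphalf_double.
suff mn : (m <= n)%N.
  have {}mn : m = n by apply/eqP; rewrite eqn_leq mn.
  by move: bm; rewrite mn /tag/= uphalf_double odd_double; apply.
have Mm : (M < m)%N by rewrite /n in nm; lia.
(* Now [r m] is the distance from [x M] to [x m], and each step of the chain [x M], [f (x 0)],
   [f (x n)], [x m] is at most [r n]. *)
have <- : maxn M m = m by lia.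
rewrite -le_r -dist_x; last lia.
apply: (@mdist_le_trans (f (x 0%N))).
  exact/ltW/(lt_trans Mx).
apply: (@mdist_le_trans (f (x n))).
  apply: le_trans (f1 _ _) _.
  by rewrite dist_x.
by rewrite metric_sym; apply/ltW/(lt_trans mx).
Qed.

(** * Almost inclusion yields a reduction *)

Lemma collapse_ball n z w : U n z -> ~ U n w -> mdist (y n) w <= mdist z w.
Proof.
move=> nz nw; have sn := mdist_ge_ball nz nw.
(* Both [y n] and [z] are within [s n] of [x n], while [w] is at least [s n] away from [z]. *)
apply: (mdist_le_trans _ (lexx _)); apply: le_trans sn.
apply: (@mdist_le_trans (x n)); last exact: ltW.
by rewrite metric_sym.
Qed.

Lemma reducible_subset S T : S `<=` T -> lipschitz_reducible (balls S) (balls T).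
Proof.
move=> ST.
have [g gP] : {g : X -> X & forall z,
    (exists n, [/\ T n, ~ S n, U n z & g z = y n]) \/
    (g z = z /\ forall n, T n -> ~ S n -> ~ U n z)}.
  apply: (@choice X X (fun z v =>
    (exists n, [/\ T n, ~ S n, U n z & v = y n]) \/
    (v = z /\ forall n, T n -> ~ S n -> ~ U n z))) => z.
  have [[n [Tn Sn nz]]|no] := pselect (exists n, [/\ T n, ~ S n & U n z]).
    by exists (y n); left; exists n.
  by exists z; right; split=> // n Tn Sn nz; apply: no; exists n.
exists g; split=> [z w|].
  case: (gP z) (gP w) => [[n [Tn Sn nz ->]]|[-> zN]].
    case=> [[m [Tm Sm mw ->]]|[-> wN]]; last exact: collapse_ball nz (wN _ _ _).
    case: (n =P m) => [->|nm]; first by rewrite mdistxx mdist_ge0.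
    (* Two different balls are collapsed one at a time, through the distance from [z] to [y m]. *)
    apply: le_trans (collapse_ball nz (@U_y m n)) _.
    rewrite metric_sym (metric_sym z); apply: collapse_ball mw _ => mz.
    exact/nm/(U_inj nz mz).
  case=> [[m [Tm Sm mw ->]]|[-> _]//].
  by rewrite metric_sym (metric_sym z); apply: collapse_ball mw (zN _ _ _).
apply/seteqP; split=> z /=.
  move=> [n Sn nz]; case: (gP z) => [[m [_ Sm mz _]]|[-> _]].
    by case: Sm; rewrite -(U_inj nz mz).
  by exists n => //; apply: ST.
case: (gP z) => [[n [_ _ _ ->]] [m _ /U_y//]|[-> zN] [n Tn nz]].
by exists n => //; apply: contrapT => Sn; apply: (zN n).
Qed.

Let near_x0 K n z : (0 < K)%N -> U n z -> (mdist (x 0%N) z < r K) = (n < K)%N.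
Proof.
move=> K0 nz; apply/idP/idP => [zK|nK].
  rewrite ltnNge; apply/negP => Kn.
  suff : mdist (x 0%N) (x n) < r K.
    by rewrite dist_x; [rewrite max0n ltNge le_r Kn|lia].
  by apply: mdist_lt_trans zK _; rewrite metric_sym; apply: lt_trans nz _.
apply: (@mdist_lt_trans (x n)); last exact: lt_trans nz _.
case: n nK {nz} => [|n] nK; first by rewrite mdistxx.
by rewrite dist_x// max0n r_incr.
Qed.

(** The ball of radius [r K] about [x 0] contains only the [U n] with [n < K], whose radii are at
    least [s K], so sending it onto the pair [x K], [y K] expands nothing inside. The pair stays
    within [r K] of [x 0], so distances to outside points do not grow either. *)
Lemma reducible_eq_tail S T K : (0 < K)%N -> T K ->
    (forall n, (K <= n)%N -> S n <-> T n) ->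
  lipschitz_reducible (balls S) (balls T).
Proof.
move=> K0 TK ST.
pose pt z := if `[< balls S z >] then x K else y K.
pose f z := if mdist (x 0%N) z < r K then pt z else z.
have x0K : mdist (x 0%N) (x K) = r K by rewrite dist_x ?max0n//; lia.
have x0pt z : mdist (x 0%N) (pt z) <= r K.
  rewrite /pt; case: ifP => _; first by rewrite x0K.
  by apply: (@mdist_le_trans (x K)); [rewrite x0K|exact/ltW/s_lt_r].
have pt_in_out z w : mdist (x 0%N) z < r K -> balls S z -> ~ balls S w ->
    mdist (x K) (y K) <= mdist z w.
  move=> zK [n Sn nz] wN; have nK : (n < K)%N by rewrite -(near_x0 K0 nz).
  have : s n <= mdist z w by apply: mdist_ge_ball nz _ => nw; apply: wN; exists n.
  by apply: le_trans; rewrite le_s ltnW.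
have pt_out z w : mdist (x 0%N) z < r K -> ~ mdist (x 0%N) w < r K ->
    mdist (pt z) w <= mdist z w.
  move=> zK wK; have rKzw := mdist_ge_ball zK wK.
  apply: (mdist_le_trans _ (lexx _)); apply: le_trans rKzw.
  by apply: mdist_le_trans (ltW zK); rewrite metric_sym.
exists f; split=> [z w|].
  rewrite /f; case: ifPn => zK; case: ifPn => wK.
  - rewrite /pt; case: asboolP => zS; case: asboolP => wS;
      rewrite ?mdistxx ?mdist_ge0//; first exact: pt_in_out.
    by rewrite metric_sym (metric_sym z); apply: pt_in_out.
  - by apply: pt_out => //; apply/negP.
  - by rewrite metric_sym (metric_sym z); apply: pt_out => //; apply/negP.
  - by [].
apply/seteqP; split=> z /=; rewrite /f; case: ifPn => zK.
- by move=> Sz; rewrite /pt asboolT//; exists K.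
- move=> [n Sn nz]; exists n => //; apply/ST => //.
  by rewrite leqNgt -(near_x0 K0 nz).
- by rewrite /pt; case: asboolP => // _ [n _ /U_y].
- move=> [n Tn nz]; exists n => //; apply/ST => //.
  by rewrite leqNgt -(near_x0 K0 nz).
Qed.

Lemma reducible_of_almost_subset a b :
  almost_subset a b -> lipschitz_reducible (balls (tag a)) (balls (tag b)).
Proof.
move=> /finite_seqP[l abl].
pose N := (\max_(i <- l) i).+1.
have abN k : a k -> (N <= k)%N -> b k.
  move=> ak; apply: contraPP => nbk; apply/negP; rewrite -ltnNge ltnS.
  have kl : k \in l by have : (a `\` b) k by []; rewrite abl.
  exact: (@leq_bigmax_seq _ _ predT id).
(* [T] is a part of [tag b] that agrees with [tag a] at large indices, so the two kinds of collapse
   can be composed through it. *)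
pose T : set nat := [set k | tag b k /\ ((k < N.*2)%N \/ tag a k)].
have [f [f1 fE]] : lipschitz_reducible (balls (tag a)) (balls T).
  (* This index is even, hence in [T] whatever [a] and [b] are. *)
  apply: (@reducible_eq_tail _ _ N.*2.+2) => //.
    by split; [|right]; rewrite /tag/= !negbK odd_double.
  move=> n Nn; split=> [an|[_ [|//]]]; last lia.
  by split; [move=> on; apply: abN (an on) _; lia|right].
have [g [g1 gE]] : lipschitz_reducible (balls T) (balls (tag b)).
  by apply: reducible_subset => k [].
exists (g \o f); split; last by rewrite fE gE.
by move=> z w; apply: le_trans (g1 _ _) (f1 _ _).
Qed.

End HonestSequence.
End UltrametricSpace.

Theorem theorem4p2 (R : realType) (X : metricType R)
    (polX : ultrametric_polish X) (honX : has_honest_increasing_seq X) :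
  exists psi : set nat -> set X,
    (forall a : set nat, clopen (psi a)) /\
    (forall a b : set nat,
       almost_subset a b <-> lipschitz_reducible (psi a) (psi b)).
Proof.
have [_ ultraX _] := polX.
have [r [x [y [_ r_incr dist_x dist_xy0 dist_xyS]]]] := honX.
exists (fun a => balls x y (tag a)); split=> [a|a b].
  exact: (balls_clopen ultraX r_incr).
split; first exact: (reducible_of_almost_subset ultraX r_incr).
exact: (almost_subset_of_reducible ultraX r_incr).
Qed.
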